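(* Let $k$ be a field of characteristic $0$. Let $f:R\to S$ be a homomorphism of commutative $k$-algebras which maps an ideal $I$ of $R$ isomorphically onto an ideal of $S$ (also denoted $I$). Assume that $S$ is locally a principal ideal ring (every localization of $S$ at a maximal ideal is a principal ideal ring) and that $S/I$ is finite-dimensional over $k$. Then the composite map $$HH_2(S/I)\xrightarrow{\ \partial\ } HH_1(S,I)\longrightarrow I\otimes_S\Omega_{S/R}$$ is surjective, where $\partial$ is the connecting homomorphism and the second map sends the class of $x\otimes r$ to $x\otimes dr$ and the class of $r\otimes x$ to $-x\otimes dr$ (for $x\in I$, $r\in S$).
   Context: Tensor products $\otimes$ without subscript are over $k$. For a commutative $k$-algebra $S$, the Hochschild complex $C_*(S)$ has $C_n(S)=S^{\otimes(n+1)}$ with the standard Hochschild boundary $b$ (in low degrees $b(x\otimes y)=xy-yx=0$ and $b(x\otimes y\otimes z)=xy\otimes z-x\otimes yz+zx\otimes y$); its homology is $HH_*(S)$. For an ideal $I$ of $S$, $C_*(S,I)$ is the kernel of the surjection $C_*(S)\to C_*(S/I)$ and $HH_*(S,I)$ is its homology; the short exact sequence $0\to C_*(S,I)\to C_*(S)\to C_*(S/I)\to 0$ gives the connecting map $\partial: HH_{n+1}(S/I)\to HH_n(S,I)$. Concretely $HH_1(S,I)$ is the quotient of $S\otimes I+I\otimes S\subseteq S\otimes S$ by the image under $b$ of $S\otimes S\otimes I+S\otimes I\otimes S+I\otimes S\otimes S$. $\Omega_{S/R}$ denotes the Kähler differentials of $S$ relative to $R$ (via $f$). *)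

(* Defs.v *)
From HB Require Import structures.
From mathcomp Require Import all_boot all_order all_algebra.
Set Implicit Arguments. Unset Strict Implicit. Unset Printing Implicit Defensive.
Import GRing.Theory.
Local Open Scope ring_scope.

Definition is_ideal (A : comNzRingType) (P : A -> Prop) : Prop :=
  [/\ P 0, (forall x y, P x -> P y -> P (x + y)) & (forall a x, P x -> P (a * x))].

Definition is_maximal_ideal (A : comNzRingType) (m : A -> Prop) : Prop :=
  [/\ is_ideal m, ~ m 1 &
      forall J : A -> Prop, is_ideal J -> (forall x, m x -> J x) ->
        (forall x, J x -> m x) \/ J 1].

(* Localization A_m at a maximal ideal m, described through representing   *)
(* fractions s/u (u outside m).                                            *)
Definition frac_eq (A : comNzRingType) (m : A -> Prop) (p q : A * A) : Prop :=
  exists w, ~ m w /\ w * (p.1 * q.2 - q.1 * p.2) = 0.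

Definition is_loc_ideal (A : comNzRingType) (m : A -> Prop) (P : A * A -> Prop) : Prop :=
  [/\ (forall p, P p -> ~ m p.2),
      (forall p q, P p -> ~ m q.2 -> frac_eq m p q -> P q),
      P (0, 1),
      (forall p q, P p -> P q -> P (p.1 * q.2 + q.1 * p.2, p.2 * q.2)) &
      (forall a v p, ~ m v -> P p -> P (a * p.1, v * p.2))].

Definition loc_ideal_principal (A : comNzRingType) (m : A -> Prop) (P : A * A -> Prop) : Prop :=
  exists g, P g /\ forall p, P p ->
    exists a, ~ m a.2 /\ frac_eq m p (a.1 * g.1, a.2 * g.2).

Definition loc_is_PIR (A : comNzRingType) (m : A -> Prop) : Prop :=
  forall P, is_loc_ideal m P -> loc_ideal_principal m P.

Definition locally_PIR (A : comNzRingType) : Prop :=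
  forall m : A -> Prop, is_maximal_ideal m -> loc_is_PIR m.

(* Tensor products over k, via their universal property.                   *)
Definition kbilinear (k : fieldType) (A B : lmodType k) (M : lmodType k)
  (beta : A -> B -> M) : Prop :=
  (forall c x x' y, beta (c *: x + x') y = c *: beta x y + beta x' y) /\
  (forall c x y y', beta x (c *: y + y') = c *: beta x y + beta x y').

(* Equality of two elements of A (x)_k B given as finite sums of pure
   tensors  sum_{(a,b) in u} a (x) b  and  sum_{(a,b) in v} a (x) b. *)
Definition tensor_eq (k : fieldType) (A B : lmodType k) (u v : seq (A * B)) : Prop :=
  forall (M : lmodType k) (beta : A -> B -> M), kbilinear beta ->
    \sum_(p <- u) beta p.1 p.2 = \sum_(p <- v) beta p.1 p.2.

(* k-bilinear maps S x S -> M that factor through (S/J) x (S/J),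
   i.e. k-bilinear maps on (S/J) x (S/J). *)
Definition kbilinear_mod (k : fieldType) (S : comAlgType k) (J : S -> Prop)
  (M : lmodType k) (beta : S -> S -> M) : Prop :=
  kbilinear beta /\ forall x s, J x -> beta x s = 0 /\ beta s x = 0.

(* w = sum_{(a,b,c) in w} a (x) b (x) c  in C_2(S) = S^{(x)3};              *)
(* b(a (x) b (x) c) = ab (x) c - a (x) bc + ca (x) b.                        *)
Definition hbound2 (k : fieldType) (S : comAlgType k) (M : lmodType k)
  (beta : S -> S -> M) (w : seq (S * S * S)) : M :=
  \sum_(t <- w) (beta (t.1.1 * t.1.2) t.2 - beta t.1.1 (t.1.2 * t.2)
                 + beta (t.2 * t.1.1) t.1.2).

(* The image of w in C_2(S/J) is a Hochschild cycle: its boundary vanishes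
   in (S/J) (x)_k (S/J). *)
Definition is_cycle_mod (k : fieldType) (S : comAlgType k) (J : S -> Prop)
  (w : seq (S * S * S)) : Prop :=
  forall (M : lmodType k) (beta : S -> S -> M), kbilinear_mod J beta ->
    hbound2 beta w = 0.

(* In C_1(S) = S (x)_k S :
   b(w) = sum_{(x,r) in u} x (x) r + sum_{(r,x) in v} r (x) x. *)
Definition hbound2_eq (k : fieldType) (S : comAlgType k)
  (w : seq (S * S * S)) (u v : seq (S * S)) : Prop :=
  forall (M : lmodType k) (beta : S -> S -> M), kbilinear beta ->
    hbound2 beta w = \sum_(p <- u) beta p.1 p.2 + \sum_(p <- v) beta p.1 p.2.

(* The group  J (x)_S Omega_{S/R}  (relative to f : R -> S), via its        *)
(* universal property: additive maps out of it are exactly functions       *)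
(* phi(x, r) = "x (x) dr" (x in J, r in S) satisfying the relations below. *)
Definition omega_form (k : fieldType) (R S : comAlgType k) (f : R -> S)
  (J : S -> Prop) (M : zmodType) (phi : S -> S -> M) : Prop :=
  [/\ (forall x x' r, J x -> J x' -> phi (x + x') r = phi x r + phi x' r),
      (forall x r r', J x -> phi x (r + r') = phi x r + phi x r'),
      (forall x r r', J x -> phi x (r * r') = phi (x * r) r' + phi (x * r') r) &
      (forall x a, J x -> phi x (f a) = 0)].

(* Equality in J (x)_S Omega_{S/R} of
     sum_{(x,r) in u} x (x) dr - sum_{(r,x) in v} x (x) dr
   and  sum_{(x,r) in t} x (x) dr. *)
Definition omega_eq (k : fieldType) (R S : comAlgType k) (f : R -> S)
  (J : S -> Prop) (u v t : seq (S * S)) : Prop :=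
  forall (M : zmodType) (phi : S -> S -> M), omega_form f J phi ->
    \sum_(p <- u) phi p.1 p.2 - \sum_(p <- v) phi p.2 p.1
    = \sum_(p <- t) phi p.1 p.2.

Definition image_set (R S : Type) (f : R -> S) (I : R -> Prop) : S -> Prop :=
  fun s => exists x, I x /\ f x = s.

(* Main.v *)
(** Write J = f(I) and B = S/J.  Since J lies in f(R), J.J (x) dS and J (x) dJ
    vanish in J (x) Omega_{S/R}.  The elements a of S such that every
    ax (x) dr is in the image form an ideal containing J, so if it were proper
    it would lie in a maximal ideal m; but it contains an element outside m, as
    follows.  As B is finite-dimensional, some e outside m is idempotent mod J
    and cuts out the local factor of B at m.  Taking t generating m locally
    with et = t mod J, and n least with t^n in J, one gets eJ = t^n eS mod J.J.
    The residue field of m is separable over k and t is nilpotent mod J, so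
    e (x) dr is always a multiple of e (x) dt.  Finally, the cycle
    sum_j (t s t^(n-1-j)) (x) t^j (x) t in C_2(B), j < n, is sent to
    (n+1) s t^n (x) dt + t^(n+1) (x) ds; taking s = t^i z the coefficient of
    t^(n+i) z (x) dt becomes n+1+i, invertible in characteristic 0, and
    descending induction on i puts all t^n z (x) dt in the image. *)
Require Import Defs.
From HB Require Import structures.
From mathcomp Require Import all_boot all_order all_algebra.
From mathcomp Require Import ring.
From Stdlib Require Import Classical.
Set Implicit Arguments. Unset Strict Implicit. Unset Printing Implicit Defensive.
Import GRing.Theory.
Local Open Scope ring_scope.

(** * Well-ordering of the naturals and subspaces of row vectors *)

Lemma nat_least (P : nat -> Prop) :
  (exists n, P n) -> exists2 n, P n & forall m, P m -> (n <= m)%N.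
Proof.
case=> n; have [d] := ubnP n; elim: d n => // d IHd n /ltnSE le_nd Pn.
case: (classic (exists2 m, P m & (m < n)%N)) => [[m Pm lt_mn]|nP].
  by apply: (IHd m) => //; exact: leq_trans le_nd.
by exists n => // m Pm; rewrite leqNgt; apply/negP => lt_mn; apply: nP; exists m.
Qed.

Lemma subspace_row_space (k : fieldType) (n : nat) (V : 'rV[k]_n -> Prop) :
  V 0 -> (forall a u v, V u -> V v -> V (a *: u + v)) ->
  exists A : 'M[k]_n, forall v, V v <-> (v <= A)%MS.
Proof.
move=> V0 Vlin.
(* Least corank means greatest rank among the row spaces inside [V]; a vector of [V] outside such a
   space could be added to it and would raise the rank. *)
have [|m [A VA ltAm] min_m] := @nat_least (fun m => exists2 A : 'M[k]_n,
    forall v, (v <= A)%MS -> V v & (n - \rank A)%N = m).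
  by exists (n - \rank (0%R : 'M[k]_n))%N, 0 => // v /submx0null ->.
exists A => v; split=> [Vv|]; last exact: VA.
apply/negPn/negP => nAv.
have ltA : (A < A + v)%MS by rewrite ltmxE addsmxSl addsmx_sub submx_refl (negPf nAv).
have /min_m : exists2 B : 'M[k]_n,
    forall v, (v <= B)%MS -> V v & (n - \rank B)%N = (n - \rank (A + v)%MS)%N.
  exists (A + v)%MS => // w /sub_addsmxP [[a b] /= ->].
  rewrite addrC [b]mx11_scalar mul_scalar_mx; apply: Vlin => //.
  by apply: VA; exact: submxMl.
rewrite -ltAm leqNgt => /negP; apply; apply: ltn_sub2l (rank_ltmx ltA).
by apply: leq_trans (rank_ltmx ltA) _; exact: rank_leq_col.
Qed.

(** * Ideal arithmetic *)

Section Ideals.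
Variables (A : comNzRingType) (L : A -> Prop).
Hypothesis idL : is_ideal L.

Lemma ideal0 : L 0. Proof. by case: idL. Qed.
Lemma idealD x y : L x -> L y -> L (x + y). Proof. by case: idL => _ + _; apply. Qed.
Lemma idealMl a x : L x -> L (a * x). Proof. by case: idL => _ _; apply. Qed.
Lemma idealMr a x : L x -> L (x * a). Proof. by rewrite mulrC; exact: idealMl. Qed.
Lemma idealN x : L x -> L (- x). Proof. by rewrite -mulN1r; exact: idealMl. Qed.
Lemma idealB x y : L x -> L y -> L (x - y).
Proof. by move=> Lx Ly; apply/idealD/idealN. Qed.
Lemma ideal_cong x y : L (x - y) -> L y -> L x.
Proof. by move=> Lxy Ly; rewrite -(subrK y x); exact: idealD. Qed.

Lemma ideal_sum (I : Type) (r : seq I) (F : I -> A) :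
  (forall i, L (F i)) -> L (\sum_(i <- r) F i).
Proof. by move=> LF; elim/big_ind: _ => //; [exact: ideal0 | exact: idealD]. Qed.

Lemma ideal_adjoin u : is_ideal (fun x => exists a b, L a /\ x = a + u * b).
Proof.
split=> [|x y [a [b [La ->]]] [c [d [Lc ->]]]|c x [a [b [La ->]]]].
- by exists 0, 0; split; [exact: ideal0 | ring].
- by exists (a + c), (b + d); split; [exact: idealD | ring].
- by exists (c * a), (c * b); split; [exact: idealMl | ring].
Qed.

End Ideals.

Lemma idealZ (k : fieldType) (S : comAlgType k) (L : S -> Prop) (c : k) x :
  is_ideal L -> L x -> L (c *: x).
Proof. by move=> idL Lx; rewrite -mulr_algl; exact: idealMl. Qed.

(** * Maximal ideals and local generators *)

Section MaximalIdeal.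
Variables (A : comNzRingType) (m : A -> Prop).
Hypothesis maxm : is_maximal_ideal m.

Lemma maximal_unit u : ~ m u -> exists a b, m a /\ 1 = a + u * b.
Proof.
case: maxm => idm _ /(_ _ (ideal_adjoin idm u)) max nmu.
have [x mx|sub|//] := max; first by exists x, 0; split=> //; ring.
by case: nmu; apply: sub; exists 0, 1; split; [exact: ideal0 idm | ring].
Qed.

Lemma maximal_prime u v : ~ m u -> ~ m v -> ~ m (u * v).
Proof.
move=> /maximal_unit[a [b [ma e1]]] nmv muv; apply: nmv.
have idm : is_ideal m by case: maxm.
have -> : v = a * v + b * (u * v) by rewrite -[LHS]mul1r e1; ring.
by apply: idealD => //; [exact: idealMr | exact: idealMl].
Qed.

Lemma loc_uniformizer : loc_is_PIR m ->
  exists2 t, m t & forall y, m y -> exists u z, ~ m u /\ u * y = t * z.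
Proof.
have [idm nm1 _] := maxm.
(* The maximal ideal of the localization: fractions with numerator in [m]. Its closure under
   [frac_eq] is the primality of [m], and the numerator of a generator serves as [t]. *)
case/(_ (fun p => ~ m p.2 /\ m p.1)) => [|[t v] /= [[nmv mt] gen]].
  split=> [p []//|p q [np mp] nq [w [nw /eqP]]||p q [np mp] [nq mq]|a v p nv [np mp]] /=.
  - rewrite mulrBr subr_eq0 => /eqP e; split=> //.
    case: (classic (m q.1)) => // nq1.
    case: (@maximal_prime (w * q.1) p.2) => //; first exact: maximal_prime.
    by rewrite -mulrA -e mulrCA; exact: idealMr.
  - by split=> //; exact: ideal0.
  - split; first exact: maximal_prime.
    by apply: idealD => //; exact: idealMr.
  - by split; [exact: maximal_prime | exact: idealMl].
exists t => // y my.
have [|[a1 a2] /= [na [w [nw /= /eqP]]]] := gen (y, 1); first by [].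
rewrite mulr1 mulrBr subr_eq0 => /eqP e.
exists (w * (a2 * v)), (w * a1); split; last by rewrite -mulrA (mulrC _ y) e; ring.
by do 2!apply: maximal_prime => //.
Qed.

End MaximalIdeal.

(** * Chain conditions and algebraicity modulo an ideal of finite codimension *)

Section FiniteCodimension.
Variables (k : fieldType) (S : comAlgType k) (J : S -> Prop).
Variables (n : nat) (e : 'I_n -> S).
Hypothesis idJ : is_ideal J.
Hypothesis spanJ :
  forall s : S, exists c : 'I_n -> k, J (s - \sum_(i < n) c i *: e i).

Lemma ideal_coords (L : S -> Prop) : is_ideal L ->
  exists A : 'M[k]_n,
    forall c : 'rV_n, L (\sum_i c 0 i *: e i) <-> (c <= A)%MS.
Proof.
move=> idL; apply: subspace_row_space => [|a u v Lu Lv].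
  by rewrite big1 => [|i _]; [exact: ideal0 idL | rewrite mxE scale0r].
have -> : \sum_i (a *: u + v) 0 i *: e i
    = a *: (\sum_i u 0 i *: e i) + \sum_i v 0 i *: e i.
  rewrite scaler_sumr -big_split; apply: eq_bigr => i _.
  by rewrite !mxE scalerDl scalerA.
by apply: idealD => //; exact: idealZ.
Qed.

(** Ideals containing [J] are determined by their subspaces of coordinate vectors, and nested
    subspaces of equal rank coincide. *)
Lemma coords_rank_inj (L L' : S -> Prop) (A A' : 'M[k]_n) :
  is_ideal L -> is_ideal L' -> (forall x, J x -> L x) ->
  (forall c : 'rV_n, L (\sum_i c 0 i *: e i) <-> (c <= A)%MS) ->
  (forall c : 'rV_n, L' (\sum_i c 0 i *: e i) <-> (c <= A')%MS) ->
  (forall x, L x -> L' x) -> (\rank A' <= \rank A)%N ->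
  forall x, L' x -> L x.
Proof.
move=> idL idL' JL LA LA' sub rk x L'x.
have sAA' : (A <= A')%MS.
  by apply/rV_subP => v /LA/sub/LA'.
have sA'A : (A' <= A)%MS.
  by have := mxrank_leqif_sup sAA' => /leqifP; case: ifP => // _; rewrite ltnNge rk.
have [c Jx] := spanJ x.
apply: (ideal_cong idL (JL _ Jx)).
have ec : \sum_(i < n) c i *: e i = \sum_i (\row_i c i) 0 i *: e i.
  by apply: eq_bigr => i _; rewrite mxE.
rewrite ec; apply/LA/(submx_trans _ sA'A)/LA'; rewrite -ec.
apply: (ideal_cong idL' _ L'x); rewrite -opprB; apply: idealN => //.
exact/sub/JL.
Qed.

Lemma minimal_ideal (C : (S -> Prop) -> Prop) :
  (forall L, C L -> is_ideal L /\ forall x, J x -> L x) -> (exists L, C L) ->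
  exists2 L, C L & forall L', C L' -> (forall x, L' x -> L x) ->
    forall x, L x -> L' x.
Proof.
move=> CJ [L0 CL0].
have [|r [L [CL [A [LA rA]]]] min] := @nat_least (fun r => exists L, C L /\
    exists A : 'M[k]_n, (forall c : 'rV_n, L (\sum_i c 0 i *: e i) <-> (c <= A)%MS)
      /\ \rank A = r).
  have [A LA] := ideal_coords (CJ _ CL0).1.
  by exists (\rank A), L0; split=> //; exists A.
exists L => // L' CL' sub.
have [A' LA'] := ideal_coords (CJ _ CL').1.
have [[idL JL] [idL' JL']] := (CJ _ CL, CJ _ CL').
apply: (coords_rank_inj idL' idL JL' LA' LA sub).
by rewrite rA; apply: min; exists L'; split=> //; exists A'.
Qed.

Lemma maximal_ideal (C : (S -> Prop) -> Prop) :
  (forall L, C L -> is_ideal L /\ forall x, J x -> L x) -> (exists L, C L) ->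
  exists2 L, C L & forall L', C L' -> (forall x, L x -> L' x) ->
    forall x, L' x -> L x.
Proof.
move=> CJ [L0 CL0].
have [|r [L [CL [A [LA rA]]]] min] := @nat_least (fun r => exists L, C L /\
    exists A : 'M[k]_n, (forall c : 'rV_n, L (\sum_i c 0 i *: e i) <-> (c <= A)%MS)
      /\ (n - \rank A)%N = r).
  have [A LA] := ideal_coords (CJ _ CL0).1.
  by exists (n - \rank A)%N, L0; split=> //; exists A.
exists L => // L' CL' sub.
have [A' LA'] := ideal_coords (CJ _ CL').1.
have [[idL JL] [idL' JL']] := (CJ _ CL, CJ _ CL').
apply: (coords_rank_inj idL idL' JL LA LA' sub).
have := min (n - \rank A')%N; rewrite -rA => /(_ _).
rewrite leqNgt => H; rewrite leqNgt; apply/negP => lt; move: H.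
rewrite ltn_sub2l // ?(leq_trans lt) ?rank_leq_col // => H.
by apply: (notF (H _)); exists L'; split=> //; exists A'.
Qed.

(** The ascending chain condition above [J] takes the place of Zorn's lemma. *)
Lemma exists_maximal_ideal (L : S -> Prop) :
  is_ideal L -> (forall x, J x -> L x) -> ~ L 1 ->
  exists2 m, is_maximal_ideal m & forall x, L x -> m x.
Proof.
move=> idL JL nL1.
have [||m [idm nm1 Lm] max] := @maximal_ideal (fun m =>
    [/\ is_ideal m, ~ m 1 & forall x, L x -> m x]).
- by move=> m [idm _ Lm]; split=> // x /JL/Lm.
- by exists L.
exists m => //; split=> // K idK mK.
case: (classic (K 1)) => [|nK1]; [by right | left].
by apply: max => //; split=> // x /Lm/mK.
Qed.

Lemma algebraic_mod (r : S) :
  exists2 p : {poly k}, p != 0 & J (horner_alg r p).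
Proof.
have /fin_all_exists [c Jc] := fun i : 'I_n.+1 => spanJ (r ^+ i).
pose M := \matrix_(i < n.+1, j < n) c i j.
(* The powers of [r] from 0 to [n] give n+1 rows of length [n], so they satisfy a linear relation
   [v]; its entries are the coefficients of the polynomial. *)
have /rowV0Pn [v /sub_kermxP vM v0] : kermx M != 0.
  by rewrite -mxrank_eq0 mxrank_ker subn_eq0 -ltnNge ltnS rank_leq_col.
exists (rVpoly v).
  by apply: contraNneq v0 => p0; rewrite -[v]rVpolyK p0 linear0.
have -> : horner_alg r (rVpoly v) = \sum_i v 0 i *: (r ^+ i - \sum_j c i j *: e j).
  under eq_bigr do rewrite scalerBr; rewrite sumrB.
  have -> : \sum_i v 0 i *: (\sum_j c i j *: e j) = 0.
    under eq_bigr do rewrite scaler_sumr; rewrite exchange_big big1 //= => j _.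
    under eq_bigr do rewrite scalerA; rewrite -scaler_suml.
    have /matrixP/(_ 0 j) := vM; rewrite mxE [RHS]mxE => vM0.
    suff -> : \sum_i v 0 i * c i j = 0 by rewrite scale0r.
    by rewrite -[RHS]vM0; apply: eq_bigr => i _; rewrite mxE.
  rewrite subr0 /rVpoly poly_def rmorph_sum /=; apply: eq_bigr => i _.
  rewrite -mul_polyC rmorphM rmorphXn /= horner_algC horner_algX mulr_algl insubT /= => [|lt_i]; first exact: ltn_ord.
  by congr (v _ _ *: _); exact: val_inj.
by apply: (ideal_sum idJ) => i; apply: idealZ.
Qed.

End FiniteCodimension.

(** * The local factor of the quotient by [J] at a maximal ideal *)

Section LocalStructure.
Variables (k : fieldType) (S : comAlgType k) (J : S -> Prop).
Variables (n : nat) (v : 'I_n -> S).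
Hypothesis idJ : is_ideal J.
Hypothesis spanJ :
  forall s : S, exists c : 'I_n -> k, J (s - \sum_(i < n) c i *: v i).
Variable m : S -> Prop.
Hypothesis maxm : is_maximal_ideal m.
Hypothesis Jm : forall x, J x -> m x.

Let idm : is_ideal m. Proof. by case: maxm. Qed.
Let nm1 : ~ m 1. Proof. by case: maxm. Qed.

(* Modulo J, a generator e of a minimal ideal e S + J among those with e
   outside m is the idempotent cutting out the localization at m. *)
Lemma local_idempotent : exists e,
  [/\ ~ m e, J (e * e - e) & forall u, ~ m u -> exists b, J (e - u * b)].
Proof.
pose adj u x := exists a b, J a /\ x = a + u * b.
have [||L [u0 [nu0 ->]] min] := @minimal_ideal _ _ J n v spanJ
    (fun L => exists u, ~ m u /\ L = adj u).
- move=> L [u [_ ->]]; split; first exact: ideal_adjoin.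
  by move=> x Jx; exists x, 0; split=> //; ring.
- by exists (adj 1), 1.
have div u : ~ m u -> exists a b, J a /\ u0 = a + u0 * u * b.
  move=> nu; apply: (min (adj (u0 * u))).
  - by exists (u0 * u); split=> //; exact: maximal_prime.
  - by move=> x [a [b [Ja ->]]]; exists a, (u * b); split=> //; ring.
  - by exists 0, 1; split; [exact: ideal0 | ring].
have [a [b [Ja e0]]] := div _ nu0.
(* Since [u0] is [u0 * u0 * b] modulo [J], the product [u0 * b] is idempotent there. *)
exists (u0 * b); split.
- move=> mu; apply: nu0; rewrite e0; apply: idealD => //; first exact: Jm.
  by rewrite -mulrA; exact: idealMl.
- have -> : u0 * b * (u0 * b) - u0 * b = - b * (u0 - u0 * u0 * b) by ring.
  by rewrite [X in X - _]e0 addrK; exact: idealMl.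
- move=> u /div [a' [c [Ja' e']]]; exists (u0 * c * b).
  have -> : u0 * b - u * (u0 * c * b) = b * (u0 - u0 * u * c) by ring.
  by rewrite [X in X - _]e' addrK; exact: idealMl.
Qed.

(** The descending chain of the ideals t^N S + J stops, so t^N (1 - t b) lies in [J] for some [b];
    as [1 - t * b] is outside [m], it divides [e] modulo [J]. *)
Lemma local_nilpotent e t : (forall u, ~ m u -> exists b, J (e - u * b)) ->
  m t -> exists N, J (e * t ^+ N).
Proof.
move=> div mt; pose adj u x := exists a b, J a /\ x = a + u * b.
have [||L [N ->] min] := @minimal_ideal _ _ J n v spanJ
    (fun L => exists N, L = adj (t ^+ N)).
- move=> L [N ->]; split; first exact: ideal_adjoin.
  by move=> x Jx; exists x, 0; split=> //; ring.
- by exists (adj (t ^+ 0)), 0%N.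
have [||| a [b [Ja eN]]] := min (adj (t ^+ N.+1)) _ _ (t ^+ N).
- by exists N.+1.
- by move=> x [a [b [Ja ->]]]; exists a, (t * b); split=> //; rewrite exprS; ring.
- by exists 0, 1; split; [exact: ideal0 | ring].
have [|c Jc] := div (1 - t * b).
  move=> mb; apply: nm1; rewrite -(subrK (t * b) 1).
  by apply: idealD => //; exact: idealMr.
exists N.
have -> : e * t ^+ N = (e - (1 - t * b) * c) * t ^+ N
    + c * (t ^+ N - t ^+ N.+1 * b) by rewrite exprS; ring.
by rewrite [X in X - t ^+ _ * _]eN addrK; apply: idealD; [|exact: idealMr|exact: idealMl].
Qed.

Lemma local_structure : loc_is_PIR m -> exists e t N,
  [/\ ~ m e, J (e * e - e) & forall u, ~ m u -> exists b, J (e - u * b)] /\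
  [/\ J (e * t - t), J (t ^+ N.+1), forall y, m y -> exists z, J (e * y - t * z) &
      forall x, J x -> exists z a, J a /\ e * x = t ^+ N.+1 * (e * z) + a * x].
Proof.
move=> pir; have [e [nme ee div]] := local_idempotent.
have [g mg gen] := loc_uniformizer maxm pir.
pose t := e * g.
have mt : m t by exact: idealMl.
have et : J (e * t - t).
  have -> : e * t - t = (e * e - e) * g by rewrite /t; ring.
  exact: idealMr.
have tgen y : m y -> exists u z, ~ m u /\ u * y = t * z.
  move=> /gen [u [z [nu uy]]]; exists (e * u), z; split; first exact: maximal_prime.
  by rewrite -mulrA uy /t; ring.
(* The least exponent putting a power of [t] in [J] is positive, since 1 is not in [m]; hence the
   form [N.+1]. *)
have [|[|N] JN min] := @nat_least (fun N => J (t ^+ N)).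
- have [N JN] := local_nilpotent div mt; exists N.+1.
  by rewrite exprS (_ : t * _ = g * (e * t ^+ N)); [exact: idealMl | rewrite /t; ring].
- by case: nm1; exact: Jm.
exists e, t, N; split=> //; split=> // [y my|x Jx].
  have [u [z [/div [b Jb] uy]]] := tgen y my; exists (b * z).
  have -> : e * y - t * (b * z) = (e - u * b) * y + b * (u * y - t * z) by ring.
  by rewrite uy subrr mulr0 addr0; exact: idealMr.
(* Factors of [t] are stripped from [x] one at a time. Should the cofactor [z] leave [m] at some j
   <= N, it would divide [e] modulo [J], so [e * t ^+ j] would lie in [J]: this contradicts [nme]
   for j = 0 and the minimality of [N.+1] otherwise. *)
have H j : (j <= N.+1)%N -> exists u z, ~ m u /\ u * x = t ^+ j * z.
  elim: j => [|j IHj] lejN; first by exists 1, x; split=> //; ring.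
  have [u [z [nu ux]]] := IHj (ltnW lejN).
  case: (classic (m z)) => [mz|/div [b Jb]]; last first.
    have Jet : J (e * t ^+ j).
      have -> : e * t ^+ j = (e - z * b) * t ^+ j + b * (t ^+ j * z) by ring.
      by rewrite -ux mulrA; apply: idealD => //; [exact: idealMr | exact: idealMl].
    case: j {IHj} lejN Jet {ux} => [|j] lejN Jet.
      by case: nme; apply: Jm; rewrite -[e]mulr1.
    have /min : J (t ^+ j.+1).
      apply: (ideal_cong idJ _ Jet).
      have -> : t ^+ j.+1 - e * t ^+ j.+1 = - (t ^+ j) * (e * t - t).
        by rewrite exprS; ring.
      exact: idealMl.
    by rewrite leqNgt lejN.
  have [u' [z' [nu' u'z]]] := tgen z mz.
  exists (u' * u), z'; split; first exact: maximal_prime.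
  by rewrite -mulrA ux mulrCA u'z exprSr; ring.
have [u [z [/div [b Jb] ux]]] := H _ (leqnn _).
(* The second witness is [e - e * u * b], written so that its membership in [J] is visible. *)
exists (b * z), (e * (e - u * b) - (e * e - e)); split.
  by apply: idealB => //; exact: idealMl.
have -> : t ^+ N.+1 * (e * (b * z)) = e * b * (u * x) by rewrite ux; ring.
by ring.
Qed.

End LocalStructure.

(** * Calculus of differentials with coefficients in [J] *)

Section Form.
Variables (k : fieldType) (R S : comAlgType k) (f : {lrmorphism R -> S}).
Variables (J : S -> Prop) (M : zmodType) (phi : S -> S -> M).
Hypothesis idJ : is_ideal J.
Hypothesis imJ : forall x, J x -> exists a, f a = x.
Hypothesis omega : omega_form f J phi.

Lemma formDl x y r : J x -> J y -> phi (x + y) r = phi x r + phi y r.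
Proof. by case: omega => + _ _ _; apply. Qed.

Lemma formDr x r s : J x -> phi x (r + s) = phi x r + phi x s.
Proof. by case: omega => _ + _ _; apply. Qed.

Lemma formM x r s : J x -> phi x (r * s) = phi (x * r) s + phi (x * s) r.
Proof. by case: omega => _ _ + _; apply. Qed.

Lemma form0l r : phi 0 r = 0.
Proof.
by apply: (addrI (phi 0 r)); rewrite -formDl ?addr0 //; exact: ideal0.
Qed.

Lemma formNl x r : J x -> phi (- x) r = - phi x r.
Proof.
move=> Jx; apply: (addrI (phi x r)).
by rewrite -formDl ?subrr ?form0l //; exact: idealN.
Qed.

Lemma formMnl x r i : J x -> phi (x *+ i) r = phi x r *+ i.
Proof.
move=> Jx; elim: i => [|i IHi]; first by rewrite !mulr0n form0l.
by rewrite !mulrS formDl ?IHi //; rewrite -mulr_natl; exact: idealMl.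
Qed.

Lemma form_scalar x c : J x -> phi x c%:A = 0.
Proof.
move=> Jx; rewrite -(rmorph1 f) -linearZ.
by case: omega => _ _ _; apply.
Qed.

Lemma form0r x : J x -> phi x 0 = 0.
Proof. by move=> Jx; rewrite -(scale0r 1) form_scalar. Qed.

Lemma form1r x : J x -> phi x 1 = 0.
Proof. by move=> Jx; rewrite -(scale1r 1) form_scalar. Qed.

Lemma formNr x r : J x -> phi x (- r) = - phi x r.
Proof. by move=> Jx; apply: (addrI (phi x r)); rewrite -formDr // !subrr form0r. Qed.

Lemma form_ideal x y : J x -> J y -> phi x y = 0.
Proof. by move=> Jx /imJ [a <-]; case: omega => _ _ _; apply. Qed.

(** Expand x d(yr) by the Leibniz rule: d(yr) and dy vanish because [y * r] and [y] come from
    [R]. *)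
Lemma form_sq x y r : J x -> J y -> phi (x * y) r = 0.
Proof.
move=> Jx Jy; have Jz z : J (x * z) by exact: idealMr.
have := formM y r Jx; rewrite (form_ideal Jx) ?(form_ideal (Jz r)) ?addr0 //; exact: idealMr.
Qed.

Lemma form_congl x y a b r : J y -> J a -> J b -> x - y = a * b ->
  phi x r = phi y r.
Proof.
move=> Jy Ja Jb e; rewrite -(subrK y x) e formDl // ?form_sq ?add0r //.
exact: idealMr.
Qed.

Lemma form_congr x r s : J x -> J (r - s) -> phi x r = phi x s.
Proof. by move=> Jx Jrs; rewrite -(subrK s r) formDr // form_ideal ?add0r. Qed.

Lemma form_exp x t i : J x -> phi x (t ^+ i) = phi (x * t ^+ i.-1) t *+ i.
Proof.
(* At i = 0 the truncated exponent [i.-1] is harmless, the multiplicity being zero. *)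
elim: i x => [|i IHi] x Jx; first by rewrite form1r.
rewrite exprS formM // IHi ?mulrS; last exact: idealMr.
rewrite addrC; congr (_ + _); case: i {IHi} => [|i]; first by rewrite !mulr0n.
by rewrite -mulrA -exprS.
Qed.

Lemma form_poly x r (p : {poly k}) : J x ->
  phi x (horner_alg r p) = phi (x * horner_alg r p^`()) r.
Proof.
elim/poly_ind: p x => [|p c IHp] x Jx.
  by rewrite deriv0 !rmorph0 mulr0 form0l form0r.
rewrite derivD derivM derivX derivC addr0 mulr1 !rmorphD !rmorphM /=.
rewrite horner_algX horner_algC formDr // form_scalar // addr0 formM //.
have JM y : J (x * y) by exact: idealMr.
by rewrite mulrDr formDl // addrC IHp // -!mulrA (mulrC r).
Qed.

Variable e : S.
Hypothesis ee : J (e * e - e).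

(** From de = d(ee) = 2e de one gets e de = 2e de, so e de = 0 and then de = 0. Only cancellation is
    used, as [M] is an arbitrary abelian group. *)
Lemma form_idem x : J x -> phi x e = 0.
Proof.
have dbl y : J y -> phi y e = phi (y * e) e + phi (y * e) e.
  by move=> Jy; rewrite -formM // (form_congr Jy ee).
move=> Jx; have Jxe : J (x * e) by exact: idealMr.
suff e0 : phi (x * e) e = 0 by rewrite dbl // e0 addr0.
apply: (addrI (phi (x * e) e)); rewrite addr0 [RHS]dbl //.
have -> // : phi (x * e * e) e = phi (x * e) e.
by apply: (form_congl _ Jxe Jx ee); ring.
Qed.

Lemma form_idemM x r : J x -> phi x (e * r) = phi (e * x) r.
Proof.
by move=> Jx; rewrite formM // (mulrC x e) [X in _ + X]form_idem ?addr0 //; exact: idealMr.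
Qed.

End Form.

(** * Differentials on the local factor are multiples of dt *)

Section Generation.
Variables (k : fieldType) (R S : comAlgType k) (f : {lrmorphism R -> S}).
Variable J : S -> Prop.
Hypothesis char0 : [pchar k] =i pred0.
Hypothesis idJ : is_ideal J.
Hypothesis imJ : forall x, J x -> exists a, f a = x.
Variables (n : nat) (v : 'I_n -> S).
Hypothesis spanJ :
  forall s : S, exists c : 'I_n -> k, J (s - \sum_(i < n) c i *: v i).
Variable m : S -> Prop.
Hypothesis maxm : is_maximal_ideal m.
Hypothesis Jm : forall x, J x -> m x.

(** Take [p] of least size among nonzero polynomials with value in [m] at [r]. In characteristic 0
    its derivative is nonzero and of smaller size, so the derivative's value avoids [m]. *)
Lemma separable_mod (r : S) :
  exists2 p : {poly k}, m (horner_alg r p) & ~ m (horner_alg r p^`()).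
Proof.
have [idm nm1 _] := maxm.
have [|d [p [p0 mp sp]] min] := @nat_least (fun d => exists p : {poly k},
    [/\ p != 0, m (horner_alg r p) & size p = d]).
  have [p p0 Jp] := algebraic_mod idJ spanJ r.
  by exists (size p), p; split=> //; exact: Jm.
exists p => // mp'.
have p'0 : p^`() != 0.
  apply/eqP => p'0.
  have sp1 : (1 < size p)%N.
    rewrite ltnNge; apply/negP => /size1_polyC ep.
    apply: nm1; rewrite ep horner_algC in mp.
    have c0 : p`_0 != 0 by apply: contraNneq p0 => c0; rewrite ep c0.
    by rewrite -[1](scalerK c0); exact: idealZ.
  have /eqP := congr1 (fun q : {poly k} => q`_(size p).-2) p'0.
  rewrite coef_deriv coef0 prednK ?ltn_predRL // -mulr_natr mulf_eq0.
  rewrite ((pcharf0P k).1 char0) -lead_coefE lead_coef_eq0 (negPf p0) /=.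
  by case: (size p) sp1 => [|[]].
have /min : exists q : {poly k},
    [/\ q != 0, m (horner_alg r q) & size q = size p^`()] by exists p^`().
by rewrite -sp leqNgt lt_size_deriv.
Qed.

Variables (e t : S) (N : nat).
Hypothesis ee : J (e * e - e).
Hypothesis div : forall u, ~ m u -> exists b, J (e - u * b).
Hypothesis et : J (e * t - t).
Hypothesis mt : forall y, m y -> exists z, J (e * y - t * z).

(* The differential of a separable equation p(r) = 0 in the residue field
   expresses e dr through dt and t dz. *)
Lemma form_step (r : S) : exists b c z, forall (M : zmodType) (phi : S -> S -> M),
  omega_form f J phi -> forall x, J x ->
  phi (e * x) r = phi (e * (b * x)) t + phi (e * (t * (c * x))) z.
Proof.
have [P [P' [/mt [z Jz] /div [b Jb] PP']]] : exists P P' : S,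
    [/\ m P, ~ m P' & forall (M : zmodType) (phi : S -> S -> M),
     omega_form f J phi -> forall x, J x -> phi x P = phi (x * P') r].
  have [p mp mp'] := separable_mod r.
  exists (horner_alg r p), (horner_alg r p^`()); split=> // M phi om x Jx.
  exact: (form_poly idJ om).
exists (b * z), b, z => M phi om x Jx.
have JM y : J (y * x) by exact: idealMl.
have JeM y : J (e * (y * x)) by exact: idealMl.
(* On the part cut out by [e], the derivative [P'] has inverse [b]. The multiple of dr thus becomes
   dP, and [e * P] is [t * z] modulo [J]. *)
have -> : phi (e * x) r = phi (e * (b * x) * P') r.
  apply: (form_congl idJ imJ om (a := e * (e - P' * b) - (e * e - e)) (b := x)) => //.
  - exact: idealMr.
  - by apply: idealB => //; exact: idealMl.
  - by ring.
rewrite -(PP' _ _ om) // -(form_idemM idJ imJ om ee) //.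
rewrite (form_congr imJ om _ Jz) // (formM om) // addrC.
congr (_ + _).
  rewrite -(form_idemM idJ imJ om ee) // (form_congr imJ om _ et) //.
  by congr (phi _ t); ring.
apply: (form_congl idJ imJ om (a := - (e * t - t)) (b := b * x)) => //.
- by do 2!apply: idealMl => //.
- exact: idealN.
- by ring.
Qed.

Hypothesis tN : J (t ^+ N).

(** Each use of [form_step] gains a factor [t] in the remainder, which dies in J.J after [N] uses.
    The coefficient [b] is chosen before [M], [phi] and [x], so that it can enter explicit
    chains. *)
Lemma form_generator (r : S) : exists b, forall (M : zmodType) (phi : S -> S -> M),
  omega_form f J phi -> forall x, J x -> phi (e * x) r = phi (e * (b * x)) t.
Proof.
have H i : exists b c z, forall (M : zmodType) (phi : S -> S -> M),
    omega_form f J phi -> forall x, J x ->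
    phi (e * x) r = phi (e * (b * x)) t + phi (e * (t ^+ i * c * x)) z.
  elim: i => [|i [b [c [z Hz]]]].
    exists 0, 1, r => M phi om x Jx.
    by rewrite mul0r mulr0 (form0l idJ om) add0r expr0 !mul1r.
  have [b' [c' [z' Hz']]] := form_step z.
  exists (b + b' * t ^+ i * c), (c' * c), z' => M phi om x Jx.
  rewrite (Hz _ _ om) // (Hz' _ _ om); last exact: idealMl.
  have Jy y : J (e * (y * x)) by do 2!apply: (idealMl idJ).
  rewrite addrA -(formDl om _ (Jy b)) ?[b' * _]mulrA //.
  by congr (phi _ _ + phi _ _); rewrite ?exprS; ring.
have [b [c [z Hz]]] := H N.
exists b => M phi om x Jx; rewrite (Hz _ _ om) //.
rewrite (_ : e * (t ^+ N * c * x) = e * c * t ^+ N * x); last by ring.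
by rewrite [X in _ + X](form_sq idJ imJ om) ?addr0 //; exact: idealMl.
Qed.

End Generation.

(** * The image of the composite map and an explicit family of cycles *)

Section Image.
Variables (k : fieldType) (R S : comAlgType k) (f : {lrmorphism R -> S}).
Variable J : S -> Prop.

Definition omega_equiv (t t' : seq (S * S)) : Prop :=
  forall (M : zmodType) (phi : S -> S -> M), omega_form f J phi ->
    \sum_(p <- t) phi p.1 p.2 = \sum_(p <- t') phi p.1 p.2.

(** The usual recipe for the connecting map: lift a cycle of the quotient to a chain [w] over [S],
    then read its boundary as a relative 1-chain, split into the parts [u] and [v]. *)
Definition in_image (t : seq (S * S)) : Prop :=
  exists (w : seq (S * S * S)) (u v : seq (S * S)),
    [/\ is_cycle_mod J w, (forall p, p \in u -> J p.1),
        (forall p, p \in v -> J p.2), hbound2_eq w u v & omega_eq f J u v t].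

Lemma in_image_equiv t t' : omega_equiv t t' -> in_image t -> in_image t'.
Proof.
move=> eq_t [w [u [v [cw Ju Jv bw om]]]]; exists w, u, v; split=> // M phi form.
by rewrite om // eq_t.
Qed.

Lemma in_image_cat t t' : in_image t -> in_image t' -> in_image (t ++ t').
Proof.
move=> [w [u [v [cw Ju Jv bw om]]]] [w' [u' [v' [cw' Ju' Jv' bw' om']]]].
exists (w ++ w'), (u ++ u'), (v ++ v'); split.
- by move=> M beta bil; rewrite /hbound2 big_cat /= [X in X + _]cw // [X in _ + X]cw' ?addr0.
- by move=> p; rewrite mem_cat => /orP[]; [exact: Ju | exact: Ju'].
- by move=> p; rewrite mem_cat => /orP[]; [exact: Jv | exact: Jv'].
- move=> M beta bil; rewrite /hbound2 !big_cat /= [X in X + _]bw // [X in _ + X]bw' //.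
  by rewrite addrACA.
- by move=> M phi form; rewrite !big_cat /= -om // -om' // opprD addrACA.
Qed.

Lemma in_image_nil : in_image [::].
Proof.
by exists [::], [::], [::]; split=> // M phi form; rewrite /hbound2 !big_nil ?addr0 ?subr0.
Qed.

Section Bilinear.
Variables (M : lmodType k) (beta : S -> S -> M).
Hypothesis bil : kbilinear beta.

Lemma bilZl c x y : beta (c *: x) y = c *: beta x y.
Proof.
have D a b : beta (a + b) y = beta a y + beta b y.
  by have := bil.1 1 a b y; rewrite !scale1r.
have b0 : beta 0 y = 0 by apply: (addrI (beta 0 y)); rewrite -D !addr0.
by rewrite -[c *: x]addr0 bil.1 b0 addr0.
Qed.

Lemma hbound2_power (a t : S) (N : nat) :
  hbound2 beta [seq (a * t ^+ (N - i), t ^+ i, t) | i <- iota 0 N.+1] =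
    beta ((a * t ^+ N) *+ N.+1) t + (beta (a * t ^+ N.+1) 1 - beta a (t ^+ N.+1)).
Proof.
(* The first boundary terms all equal [beta (a * t ^+ N) t]; the other two are [g i - g i.+1] and
   telescope. *)
rewrite /hbound2 big_map -[iota 0 N.+1]/(index_iota 0 N.+1) /=.
pose g i := beta (a * t ^+ (N.+1 - i)) (t ^+ i).
have -> : beta (a * t ^+ N.+1) 1 - beta a (t ^+ N.+1) = g 0%N - g N.+1.
  by rewrite /g subn0 subnn expr0 mulr1.
rewrite -opprB -telescope_sumr // -sumrN -scaler_nat bilZl scaler_nat.
have -> : beta (a * t ^+ N) t *+ N.+1 = \sum_(0 <= i < N.+1) beta (a * t ^+ N) t.
  by rewrite sumr_const_nat subn0.
rewrite -big_split /=; apply: eq_big_nat => i /andP[_ lt_i].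
rewrite -mulrA -exprD subnK // -addrA; congr (_ + _).
rewrite /g subSS opprB addrC -exprSr mulrCA -exprS.
by rewrite subSn.
Qed.

End Bilinear.

Hypothesis idJ : is_ideal J.

Lemma in_image_power (s t : S) (N : nat) : J (t ^+ N.+1) ->
  in_image [:: ((t ^+ N.+1 * s) *+ N.+2, t); (t ^+ N.+2, s)].
Proof.
move=> JN; pose a := t * s.
have eaN : a * t ^+ N = t ^+ N.+1 * s by rewrite /a exprS; ring.
have JMn x i : J x -> J (x *+ i) by move=> Jx; rewrite -mulr_natl; exact: idealMl.
exists [seq (a * t ^+ (N - i), t ^+ i, t) | i <- iota 0 N.+1].
(* The sign sits on [a] because [v] holds pairs, not signed tensors. Its contribution is t^(N+1)
   d(ts), whose Leibniz expansion raises the coefficient of dt from N+1 to N+2. *)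
exists [:: ((a * t ^+ N) *+ N.+1, t); (a * t ^+ N.+1, 1)], [:: (- a, t ^+ N.+1)].
split.
- move=> M beta [bil betaJ]; rewrite hbound2_power // eaN.
  have [-> _] : beta ((t ^+ N.+1 * s) *+ N.+1) t = 0 /\ beta t ((t ^+ N.+1 * s) *+ N.+1) = 0.
    by apply: betaJ; apply: JMn; exact: idealMr.
  have [-> _] := betaJ (a * t ^+ N.+1) 1 (idealMl idJ a JN).
  have [_ ->] := betaJ _ a JN.
  by rewrite subrr addr0.
- move=> p; rewrite !inE => /orP[]/eqP-> /=; last exact: idealMl.
  by apply: JMn; rewrite eaN; exact: idealMr.
- by move=> p; rewrite inE => /eqP->.
- move=> M beta bil; rewrite hbound2_power // !big_cons !big_nil /= !addr0 addrA.
  by rewrite -[- a]scaleN1r bilZl // scaleN1r.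
- move=> M phi om; rewrite !big_cons !big_nil /= !addr0.
  rewrite (form1r om) ?addr0; last exact: idealMl.
  rewrite (formNr om) // opprK eaN (formM om) // -exprSr.
  rewrite (formMnl idJ om); last exact: idealMr.
  rewrite (formMnl idJ om) ?mulrSr; last exact: idealMr.
  by rewrite addrA addrAC.
Qed.

End Image.

(** * Descending induction on the power of the uniformizer *)

Section Uniformizer.
Variables (k : fieldType) (R S : comAlgType k) (f : {lrmorphism R -> S}).
Variable J : S -> Prop.
Hypothesis char0 : [pchar k] =i pred0.
Hypothesis idJ : is_ideal J.
Hypothesis imJ : forall x, J x -> exists a, f a = x.
Variables (e t : S) (N : nat).
Hypothesis et : J (e * t - t).
Hypothesis tN : J (t ^+ N.+1).
Hypothesis gen : forall r, exists b, forall (M : zmodType) (phi : S -> S -> M),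
  omega_form f J phi -> forall x, J x -> phi (e * x) r = phi (e * (b * x)) t.

(* Descending induction on the order i: the cycle for s = t^i z reaches
   (N + 2 + i) t^(N+1+i) z (x) dt up to terms of order i + 1, and the integer
   factor is invertible in characteristic 0. *)
Lemma in_image_uniformizer (z : S) (i : nat) :
  in_image f J [:: (t ^+ (N.+1 + i) * z, t)].
Proof.
have [d] := ubnP (N.+1 - i); elim: d i z => // d IHd i z lt_d.
have JN j y : J (t ^+ (N.+1 + j) * y) by apply: idealMr => //; rewrite exprD; exact: idealMr.
(* For i >= N+1 both t^(N+1) and t^i lie in [J], so the coefficient is in J.J. *)
have [le_Ni|lt_iN] := leqP N.+1 i.
  apply: (in_image_equiv _ (in_image_nil f J)) => M phi om.
  rewrite big_nil big_seq1 /= exprD -mulrA (form_sq idJ imJ om) //.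
  by rewrite -(subnKC le_Ni).
pose q : k := (N.+2 + i)%:R.
have q0 : q != 0 by rewrite ((pcharf0P k).1 char0).
pose y := q^-1 *: z.
have [b Hb] := gen y.
have lt'_d : (N.+1 - i.+1 < d)%N by rewrite subnS prednK ?subn_gt0.
(* Expanding t^(N+2) d(t^i y) adds [i] to the coefficient N+2 and leaves t^(N+2+i) dy. That
   remainder is a multiple of dt of order i+1, cancelled by the induction hypothesis at
   [- (e * b)]. *)
have img := in_image_cat (in_image_power f idJ (t ^+ i * y) tN)
                         (IHd i.+1 (- (e * b)) lt'_d).
apply: (in_image_equiv _ img) => M phi om; rewrite !big_cons !big_nil /= !addr0.
have JN2 j : J (t ^+ (N.+2 + j)) by rewrite addSnnS -[X in J X]mulr1.
rewrite (formM om); last by rewrite -[N.+2]addn0.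
rewrite (form_exp idJ om); last by rewrite -{1}[N.+2]addn0; apply: idealMr.
have -> : phi (t ^+ N.+2 * y * t ^+ i.-1) t *+ i = phi (t ^+ (N.+1 + i) * y) t *+ i.
  have [i0|i_gt0] := posnP i; first by rewrite [in LHS]i0 [in RHS]i0 !mulr0n.
  by rewrite mulrAC -exprD addSnnS prednK.
have -> : t ^+ N.+2 * t ^+ i = t ^+ (N.+2 + i) by rewrite exprD.
have -> : phi (t ^+ (N.+2 + i)) y = phi (t ^+ (N.+1 + i.+1) * (e * b)) t.
  rewrite (_ : _ * (e * b) = e * (b * t ^+ (N.+2 + i))); last by rewrite -addSnnS; ring.
  rewrite -Hb //; symmetry.
  apply: (form_congl idJ imJ om (a := e * t - t) (b := t ^+ (N.+1 + i))) => //.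
    by rewrite -[X in J X]mulr1.
  by rewrite addSn exprS; ring.
rewrite mulrN (formNl idJ om) // mulrA -exprD (formMnl idJ om) //.
rewrite [X in _ + X]addrAC subrr add0r.
rewrite -mulrnDr -(formMnl idJ om) //; congr (phi _ t).
rewrite -mulrnAr; congr (_ * _).
by rewrite /y -scaler_nat scalerA mulfV // scale1r.
Qed.

End Uniformizer.

(** * From local to global *)

Section Surjectivity.
Variables (k : fieldType) (R S : comAlgType k) (f : {lrmorphism R -> S}).
Variable J : S -> Prop.
Hypothesis char0 : [pchar k] =i pred0.
Hypothesis idJ : is_ideal J.
Hypothesis imJ : forall x, J x -> exists a, f a = x.
Variables (n : nat) (v : 'I_n -> S).
Hypothesis spanJ :
  forall s : S, exists c : 'I_n -> k, J (s - \sum_(i < n) c i *: v i).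

Definition reached (a : S) : Prop :=
  forall x r, J x -> in_image f J [:: (a * x, r)].

Lemma reached_ideal : is_ideal reached.
Proof.
split=> [x r Jx|a a' ra ra' x r Jx|b a ra x r Jx].
- apply: (in_image_equiv _ (in_image_nil f J)) => M phi om.
  by rewrite big_nil big_seq1 /= mul0r (form0l idJ om).
- apply: (in_image_equiv _ (in_image_cat (ra _ r Jx) (ra' _ r Jx))) => M phi om.
  rewrite !big_cons !big_nil /= !addr0 mulrDl (formDl om) //; exact: idealMl.
- rewrite (mulrC b) -mulrA; apply: ra; exact: idealMl.
Qed.

Lemma reached_J a : J a -> reached a.
Proof.
move=> Ja x r Jx; apply: (in_image_equiv _ (in_image_nil f J)) => M phi om.
by rewrite big_nil big_seq1 /= (form_sq idJ imJ om).
Qed.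

Lemma reached_local (m : S -> Prop) :
  is_maximal_ideal m -> loc_is_PIR m -> (forall x, J x -> m x) ->
  exists2 e, ~ m e & reached e.
Proof.
move=> maxm pir Jm.
have [e [t [N [[nme ee div] [et tN mt JtN]]]]] :=
  local_structure idJ spanJ maxm Jm pir.
have gen := form_generator char0 idJ imJ spanJ maxm Jm ee div et mt tN.
exists e => // x r Jx.
have [b Hb] := gen r; have [z [a [Ja ex]]] := JtN x Jx.
(* Here e x dr = e b x dt, and [e * x] is [t ^+ N.+1 * (e * z)] modulo J.J, so order 0 suffices. *)
have img := in_image_uniformizer char0 idJ imJ et tN gen (b * (e * z)) 0.
apply: (in_image_equiv _ img) => M phi om; rewrite !big_seq1 /= addn0 (Hb _ _ om) //.
symmetry; apply: (form_congl idJ imJ om (a := b * a) (b := x)) => //.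
- exact: idealMr.
- exact: idealMl.
- by rewrite mulrCA ex; ring.
Qed.

Lemma in_image_all (t : seq (S * S)) : locally_PIR S ->
  (forall p, p \in t -> J p.1) -> in_image f J t.
Proof.
move=> pir.
have r1 : reached 1.
  apply: NNPP => nr1.
  have [m maxm rm] := exists_maximal_ideal spanJ reached_ideal reached_J nr1.
  have [e nme re] := reached_local maxm (pir _ maxm) (fun x Jx => rm x (reached_J Jx)).
  by apply: nme; exact: rm.
elim: t => [_|[x r] t IHt Jt]; first exact: in_image_nil.
rewrite -cat1s; apply: in_image_cat; last first.
  by apply: IHt => p pt; apply: Jt; rewrite inE pt orbT.
by rewrite -[x]mul1r; apply: r1; apply: (Jt (x, r)); rewrite mem_head.
Qed.

End Surjectivity.

Unset Implicit Arguments. Set Strict Implicit. Set Printing Implicit Defensive.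

Theorem theorem1p2 (k : fieldType) (R S : comAlgType k)
    (f : {lrmorphism R -> S}) (I : R -> Prop) :
  [pchar k] =i pred0 ->
  is_ideal I ->
  (forall x y, I x -> I y -> f x = f y -> x = y) ->
  is_ideal (image_set f I) ->
  locally_PIR S ->
  (exists (n : nat) (e : 'I_n -> S), forall s : S,
     exists c : 'I_n -> k, image_set f I (s - \sum_(i < n) c i *: e i)) ->
  forall t : seq (S * S), (forall p, p \in t -> image_set f I p.1) ->
  exists (w : seq (S * S * S)) (u v : seq (S * S)),
    [/\ is_cycle_mod (image_set f I) w,
        (forall p, p \in u -> image_set f I p.1),
        (forall p, p \in v -> image_set f I p.2),
        hbound2_eq w u v &
        omega_eq f (image_set f I) u v t].
Proof.
move=> char0 _ _ idJ pir [n [v spanJ]] t Jt.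
by apply: (in_image_all char0 idJ _ spanJ pir Jt) => x [a [_ <-]]; exists a.
Qed.
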